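(* Let $q$ be a positive integer, let $\Sigma_q=\{0,1,\dots,q-1\}$, and let $P\subseteq\Sigma_q^*$ be a finite set of nonempty words (blocks). Assume: (C1) every two distinct blocks $u,v\in P$ with $|u|=|v|$ pass the same-length boundary test; (C2) every ordered pair $(x,y)\in P^2$ with $|x|<|y|$ passes the two-stage unequal-length test (with respect to $P$). Then, for every $n\ge 0$, the code $C_n(P)=P^*\cap\Sigma_q^n$ is correcting, i.e. $B(c)\cap B(c')=\emptyset$ for all distinct $c,c'\in C_n(P)$.
   Context: For $c=c_1\cdots c_n\in\Sigma_q^n$, the radius-one ball $B(c)$ is the set of all words $z=z_1\cdots z_n$ with $z_i=c_{\pi(i)}$ for some permutation $\pi$ of $\{1,\dots,n\}$ satisfying $|\pi(i)-i|\le 1$ for all $i$; equivalently, all words obtained from $c$ by swapping the symbols in any set of pairwise disjoint pairs of adjacent positions. $P^*=\{p_1p_2\cdots p_m : m\ge 0,\ p_i\in P\}$ is the set of all finite concatenations of blocks (including the empty word $\epsilon$). For $d\ge0$, $\mathrm{Pref}_d(P^* )$ is the set of length-$d$ prefixes of words in $P^*$ (of length at least $d$). $\mathrm{pref}_k(w)$ is the length-$k$ prefix of a word $w$. For $u,v\in\Sigma_q^\ell$, $D_{\min}(u,v)=\min\{d_{\mathrm H}(u',v') : u'\in B(u),\ v'\in B(v)\}$, where $d_{\mathrm H}$ is Hamming distance. When $D_{\min}(u,v)=1$, a closest witness is a pair $(u',v')\in B(u)\times B(v)$ with $d_{\mathrm H}(u',v')=1$. Same-length boundary test: for $u,v\in\Sigma_q^\ell$,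 the pair $(u,v)$ passes if (E1) $D_{\min}(u,v)\ne0$; and (E2) if $D_{\min}(u,v)=1$, then no closest witness differs in the last coordinate $\ell$. Two-stage unequal-length test: for $x,y\in P$ with $\ell_x=|x|<\ell_y=|y|$, put $d=\ell_y-\ell_x$ and $y_0=\mathrm{pref}_{\ell_x}(y)$. The ordered pair $(x,y)$ passes if (U1) $D_{\min}(x,y_0)\ne0$; and (U2) if $D_{\min}(x,y_0)=1$, then for every $\rho\in\mathrm{Pref}_d(P^* )$ the same-length pair $(x\rho,y)$ passes the same-length boundary test. *)

(* Defs.v *)
(* Words over an alphabet T are sequences [seq T]; positions are
   numbered from 0. *)
From mathcomp Require Export all_boot all_fingroup finmap.

Set Implicit Arguments.
Unset Strict Implicit.
Unset Printing Implicit Defensive.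

Section Words.
Variable T : eqType.
Implicit Types (c u v w x y z : seq T).

(* |s i - i| <= 1, without truncated subtraction *)
Definition near_id n (s : 'S_n) : bool :=
  [forall i : 'I_n, (s i <= i.+1) && (i <= (s i).+1)].

Definition permute_word c (s : 'S_(size c)) : seq T :=
  [seq tnth (in_tuple c) (s i) | i <- enum 'I_(size c)].

(* The radius-one ball; repetitions in this list are irrelevant. *)
Definition ball c : seq (seq T) :=
  [seq permute_word s | s <- enum 'S_(size c) & near_id s].

(* Meaningful for words of equal length only. *)
Definition hamming u v : nat := count (fun p => p.1 != p.2) (zip u v).

(* The initial value [hamming u v] is itself one of the values minimized over,
   as u and v belong to their own balls. *)
Definition Dmin u v : nat :=
  \big[minn/hamming u v]_(u' <- ball u)
    \big[minn/hamming u v]_(v' <- ball v) hamming u' v'.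

Definition closest_witness u v u' v' : Prop :=
  [/\ u' \in ball u, v' \in ball v & hamming u' v' = 1].

(* Intended for [size u = size v = l]; the last coordinate has index l - 1. *)
Definition same_length_test u v : Prop :=
  Dmin u v <> 0 /\
  (Dmin u v = 1 -> forall u' v', closest_witness u v u' v' ->
     ~ (onth u' (size u).-1 <> onth v' (size u).-1)).

End Words.

Section Codes.
Variable T : choiceType.
Implicit Types (P : {fset seq T}) (c w x y z rho : seq T).

Definition star P w : Prop :=
  exists ps : seq (seq T), {subset ps <= P} /\ w = flatten ps.

Definition Pref P (d : nat) rho : Prop :=
  exists w, [/\ star P w, d <= size w & rho = take d w].

(* Intended for [size x < size y]. *)
Definition two_stage_test P x y : Prop :=
  let d := size y - size x in
  let y0 := take (size x) y in
  Dmin x y0 <> 0 /\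
  (Dmin x y0 = 1 -> forall rho, Pref P d rho -> same_length_test (x ++ rho) y).

Definition code P (n : nat) c : Prop := star P c /\ size c = n.

Definition correcting (C : seq T -> Prop) : Prop :=
  forall c c', C c -> C c' -> c <> c' ->
    ~ exists z, z \in ball c /\ z \in ball c'.

End Codes.

(* Main.v *)
Require Import Defs.
From mathcomp Require Import zify.

Set Implicit Arguments.
Unset Strict Implicit.
Unset Printing Implicit Defensive.

(* Let z lie in the balls of two codewords u ++ w and v ++ w' with
   |u| = |v|. At most one symbol of u and one symbol of v cross the boundary
   after position |u|; if both words are cut there and the crossing symbols are
   put back, u and v have ball elements that agree except perhaps in the last
   coordinate. So a pair passing the same-length test cannot start two colliding
   codewords, and for blocks x, y with |x| < |y| either (U1) fails for x and the
   prefix of y, or (U2) applies to y and the prefix of length |y| of the other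
   codeword. Two colliding codewords therefore share their first block, which
   can be cancelled letter by letter: if B(aw) and B(aw') meet, so do B(w) and
   B(w'). *)

(** * Disjoint adjacent swaps as an inductive relation *)

Section AdjacentSwaps.
Variable T : eqType.
Implicit Types (a b : T) (c u v w z : seq T).

(** The ball read from left to right: each letter is kept or exchanged with its successor, so the
    swapped pairs are disjoint by construction. [mem_ballP] identifies this relation with membership
    in [ball]. *)
Inductive adj_swap : seq T -> seq T -> Prop :=
| adj_swap_nil : adj_swap [::] [::]
| adj_swap_cons a c z : adj_swap c z -> adj_swap (a :: c) (a :: z)
| adj_swap_swap a b c z :
    adj_swap c z -> adj_swap [:: a, b & c] [:: b, a & z].

Lemma adj_swap_size c z : adj_swap c z -> size z = size c.
Proof. by elim=> //= *; congruence. Qed.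

Lemma adj_swap_rcons c z a :
  adj_swap c z -> adj_swap (rcons c a) (rcons z a).
Proof.
elim=> [|b c' z' _ IH|b b' c' z' _ IH] /=.
- exact/adj_swap_cons/adj_swap_nil.
- exact: adj_swap_cons.
- exact: adj_swap_swap.
Qed.

(** The witness is [z] with one [a] removed. If only one side swaps its leading [a], the partner
    letter must equal [a] as well, and the swap acts as keeping both. If both sides swap, [w] and
    [w'] start with the same letter, which is kept. *)
Lemma adj_swap_behead a w w' z :
  adj_swap (a :: w) z -> adj_swap (a :: w') z ->
  exists z', adj_swap w z' /\ adj_swap w' z'.
Proof.
move=> Hw Hw'.
inversion Hw as [|? ? z1 H1|? b c1 z1 H1]; subst;
  inversion Hw' as [|? ? z2 H2|? b' c2 z2 H2]; subst; eexists; split.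
- exact: H1.
- exact: H2.
- exact: H1.
- exact: adj_swap_cons H2.
- exact: adj_swap_cons H1.
- exact: H2.
- exact: adj_swap_cons H1.
- exact: adj_swap_cons H2.
Qed.

Lemma adj_swap_cancel u w w' z :
  adj_swap (u ++ w) z -> adj_swap (u ++ w') z ->
  exists z', adj_swap w z' /\ adj_swap w' z'.
Proof.
elim: u z => [|a u IH] z /=; first by exists z.
by move=> H H'; have [z' [/IH]] := adj_swap_behead H H'; apply.
Qed.

Lemma adj_swap_cat u w z : adj_swap (u ++ w) z ->
  (exists z1 z2, [/\ z = z1 ++ z2, adj_swap u z1 & adj_swap w z2]) \/
  (exists u0 a b z1 z2, [/\ u = rcons u0 a, z = z1 ++ [:: b, a & z2]
                          & adj_swap u0 z1]).
Proof.
move: {-1}(u ++ w) (erefl (u ++ w)) => c + H.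
elim: H u w => {c z} [|a c z Hcz IH|a b c z Hcz IH] [|a0 u] w //=.
- by move=> ->; left; exists [::], [::]; split=> //; apply: adj_swap_nil.
- move=> ->; left; exists [::], (a :: z).
  by split=> //; [apply: adj_swap_nil | apply: adj_swap_cons].
- case=> -> /IH [[z1 [z2 [-> H1 H2]]]|[u0 [a1 [b1 [z1 [z2 [-> -> H1]]]]]]].
    by left; exists (a :: z1), z2; split=> //; apply: adj_swap_cons.
  right; exists (a :: u0), a1, b1, (a :: z1), z2.
  by split=> //; apply: adj_swap_cons.
- move=> ->; left; exists [::], [:: b, a & z].
  by split=> //; [apply: adj_swap_nil | apply: adj_swap_swap].
(* A prefix of one letter ends inside the swapped pair: this is where the swap straddles the cut. *)
- case: u => [|b0 u] /= [->].
    move=> _; right; exists [::], a, b, [::], z.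
    by split=> //; apply: adj_swap_nil.
  case=> -> /IH [[z1 [z2 [-> H1 H2]]]|[u0 [a1 [b1 [z1 [z2 [-> -> H1]]]]]]].
    by left; exists [:: b, a & z1], z2; split=> //; apply: adj_swap_swap.
  right; exists [:: a, b & u0], a1, b1, [:: b, a & z1], z2.
  by split=> //; apply: adj_swap_swap.
Qed.

Lemma adj_swap_boundary u v w w' z : size u = size v ->
  adj_swap (u ++ w) z -> adj_swap (v ++ w') z ->
  exists u' v', [/\ adj_swap u u', adj_swap v v' &
    u' = v' \/ exists z0 a b, u' = rcons z0 a /\ v' = rcons z0 b].
Proof.
move=> suv /adj_swap_cat Hu /adj_swap_cat Hv.
case: Hu suv Hv => [[z1 [z2 [-> H1 _]]]|[u0 [a [b [z1 [z2 [-> -> H1]]]]]]] + Hv;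
  case: Hv => [[y1 [y2 [E H2 _]]]|[v0 [a' [b' [y1 [y2 [-> E H2]]]]]]];
  rewrite ?size_rcons => suv.
- exists z1, y1; split=> //; left.
  move/eqP: E; rewrite eqseq_cat; first by case/andP=> /eqP.
  by rewrite (adj_swap_size H1) (adj_swap_size H2).
- exists z1, (rcons y1 a'); split=> //; first exact: adj_swap_rcons.
  (* In [z] the last place of the prefix holds [b'], brought in from [w']; restoring [a'], the last
     letter of [v], alters that place only. *)
  right; exists y1, b', a'; split=> //.
  move/eqP: E; rewrite -cat_rcons eqseq_cat; first by case/andP=> /eqP.
  by rewrite size_rcons (adj_swap_size H1) (adj_swap_size H2).
- exists (rcons z1 a), y1; split=> //; first exact: adj_swap_rcons.
  right; exists z1, a, b; split=> //.
  move/eqP: E; rewrite -cat_rcons eqseq_cat; first by case/andP=> /eqP.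
  by rewrite size_rcons (adj_swap_size H1) (adj_swap_size H2).
- exists (rcons z1 a), (rcons y1 a'); split; try exact: adj_swap_rcons.
  move/eqP: E; rewrite eqseq_cat; last first.
    by rewrite (adj_swap_size H1) (adj_swap_size H2); case: suv.
  by case/andP=> /eqP -> _; right; exists y1, a, a'.
Qed.

End AdjacentSwaps.

(** * Permutations of displacement at most one are disjoint adjacent swaps *)

Section Ball.
Variable T : eqType.
Implicit Types (a b : T) (c u v w z : seq T).

(** A permutation and its inverse as plain functions on indices, so that inductions can shift
    indices without changing the type ['S_n]. *)
Definition near_bij n (f g : nat -> nat) : Prop := forall i, i < n ->
  [/\ f i < n /\ g i < n, g (f i) = i, f (g i) = i & f i <= i.+1 /\ i <= (f i).+1].

Lemma size_permute_word c (s : 'S_(size c)) :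
  size (permute_word s) = size c.
Proof. by rewrite size_map size_enum_ord. Qed.

Lemma onth_permute_word c (s : 'S_(size c)) (i : 'I_(size c)) :
  onth (permute_word s) i = onth c (s i).
Proof.
rewrite onth_map onthE (nth_map i) ?size_enum_ord // nth_ord_enum /=.
by apply/esym; have /tnth_onth := erefl (tnth (in_tuple c) (s i)).
Qed.

Lemma mem_ball_near_bij c z : z \in ball c <->
  exists f g, [/\ near_bij (size c) f g, size z = size c &
                forall i, i < size c -> onth z i = onth c (f i)].
Proof.
split.
- case/mapP=> s; rewrite mem_filter => /andP[/forallP Hs _] ->.
  (* Extension by the identity outside the range of positions. *)
  pose ext (t : 'S_(size c)) i := if insub i is Some k then t k : nat else i.
  have extE t (i : 'I_(size c)) : ext t i = t i by rewrite /ext valK.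
  exists (ext s), (ext (s^-1)%g); split; last 1 first.
  + by move=> i Hi; rewrite (extE s (Ordinal Hi)) -onth_permute_word.
  + move=> i Hi; pose k := Ordinal Hi; rewrite -[i]/(val k) !extE permK permKV.
    by split=> //; apply/andP/Hs.
  + exact: size_permute_word.
- case=> f [g [fg sz zf]].
  have fP (i : 'I_(size c)) : f i < size c by case: (fg i (ltn_ord i)) => [[]].
  have inj : injective (fun i => Ordinal (fP i)).
    move=> i j [E]; apply/val_inj; rewrite /=.
    have [_ gfi _ _] := fg i (ltn_ord i); have [_ gfj _ _] := fg j (ltn_ord j).
    by rewrite -gfi E gfj.
  apply/mapP; exists (perm inj).
    rewrite mem_filter mem_enum inE andbT; apply/forallP=> i.
    by rewrite permE /=; case: (fg i (ltn_ord i)) => _ _ _ [-> ->].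
  apply: eq_from_onth_le; rewrite size_permute_word sz maxnn => i Hi.
  by rewrite zf // (onth_permute_word _ (Ordinal Hi)) permE.
Qed.

(** The bound leaves [f 0] equal to 0 or 1. In the first case position 0 is fixed; in the second,
    [f] exchanges 0 and 1. The rest is again such a bijection, shifted down by one or two. *)
Lemma near_bij_adj_swap c z f g : near_bij (size c) f g -> size z = size c ->
  (forall i, i < size c -> onth z i = onth c (f i)) -> adj_swap c z.
Proof.
have [n] := ubnP (size c); elim: n c z f g => // n IH [|a c] z f g.
  by move=> _ _ /size0nil -> _; apply: adj_swap_nil.
case: z => //= b z; rewrite ltnS => cn fg [sz] zf.
have [[f0 g0] gf0 fg0 [f1 _]] := fg 0 isT.
have [E|fN] := eqVneq (f 0) 0.
  have := zf 0 isT; rewrite E => -[Eb].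
  rewrite {}Eb.
  have fg' : forall i, i < size c -> 0 < f i.+1 /\ 0 < g i.+1.
    move=> i Hi; have [_ gf fg1 _] := fg i.+1 Hi.
    split; rewrite lt0n; apply/eqP=> E'.
      by move: gf; rewrite E' -E gf0.
    by move: fg1; rewrite E' E.
  apply/adj_swap_cons/(IH _ _ (fun i => (f i.+1).-1) (fun i => (g i.+1).-1)) => //.
    move=> i Hi; have [Fi Gi] := fg' i Hi; have [[h1 h2] h3 h4 h5] := fg i.+1 Hi.
    by rewrite !prednK // h3 h4; split=> //; lia.
  move=> i Hi; have := zf i.+1 Hi; have [] := fg' i Hi.
  by case: (f i.+1).
have E : f 0 = 1 by lia.
case: c => [|a' c] in sz cn f0 f1 fg zf gf0 fg0 g0 *; first by move: f0; rewrite E.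
case: z => // b' z in sz zf *.
(* The preimage [g 0] of 0 is at most 1, and it is not 0 because [f 0] is 1. *)
have E' : f 1 = 0.
  have [_ _ _ [_]] := fg _ g0.
  by case: (g 0) fg0 => [|[|k]] //; [rewrite E | move=> ->].
have := zf 0 isT; rewrite E => -[Eb].
have := zf 1 isT; rewrite E' => -[Eb'].
rewrite {}Eb {}Eb'.
have G0 : g 0 = 1 by have [_ gf _ _] := fg 1 isT; rewrite E' in gf.
have G1 : g 1 = 0 by rewrite E in gf0.
(* Injectivity keeps later indices away from 0 and 1, so the shift by two does not truncate. *)
have fg' : forall i, i < size c -> 1 < f i.+2 /\ 1 < g i.+2.
  move=> i Hi; have [_ gf fg1 _] := fg i.+2 Hi.
  split.
    by case: (f i.+2) gf => [|[|k]] //; rewrite ?G0 ?G1.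
  by case: (g i.+2) fg1 => [|[|k]] //; rewrite ?E ?E'.
apply/adj_swap_swap/(IH _ _ (fun i => (f i.+2).-2) (fun i => (g i.+2).-2)).
- by move: cn => /=; lia.
- move=> i Hi; have [Fi Gi] := fg' i Hi; have [[h1 h2] h3 h4 h5] := fg i.+2 Hi.
  have -> : (f i.+2).-2.+2 = f i.+2 by lia.
  have -> : (g i.+2).-2.+2 = g i.+2 by lia.
  by rewrite h3 h4 /=; move: h1 h2 => /=; split=> //; lia.
- by case: sz.
- move=> i Hi; have := zf i.+2 Hi; have [] := fg' i Hi.
  by case: (f i.+2) => [|[|k]].
Qed.

(** Disjoint swaps form an involution, so [f] serves as its own inverse. *)
Lemma adj_swap_near_bij c z : adj_swap c z -> exists f,
  near_bij (size c) f f /\ forall i, i < size c -> onth z i = onth c (f i).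
Proof.
elim=> [|a c' z' _ [f [fP zf]]|a b c' z' _ [f [fP zf]]].
- by exists id.
- exists (fun i => if i is j.+1 then (f j).+1 else 0); split=> [|[|i]] //=.
    by move=> [|i] //= Hi; case: (fP i Hi) => [[h1 h2] h3 h4 h5]; rewrite h3.
  exact: zf.
- exists (fun i => match i with 0 => 1 | 1 => 0 | j.+2 => (f j).+2 end).
  split=> [|[|[|i]]] //=; last exact: zf.
  by move=> [|[|i]] //= Hi; case: (fP i Hi) => [[h1 h2] h3 h4 h5]; rewrite h3.
Qed.

Lemma mem_ballP c z : z \in ball c <-> adj_swap c z.
Proof.
rewrite mem_ball_near_bij; split=> [[f [g [fg sz zf]]]|H].
  exact: near_bij_adj_swap fg sz zf.
have [f [fP zf]] := adj_swap_near_bij H.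
by exists f, f; split=> //; apply: adj_swap_size.
Qed.

End Ball.

(** * What a collision implies for two prefixes of equal length *)

Section BoundaryTests.
Variable T : eqType.
Implicit Types (a b : T) (u v w z : seq T).

Lemma geq_big_minn (I : eqType) (r : seq I) d (F : I -> nat) i :
  i \in r -> \big[minn/d]_(j <- r) F j <= F i.
Proof.
elim: r => // j r IH; rewrite inE big_cons => /orP[/eqP <-|/IH Hi].
  exact: geq_minl.
exact: leq_trans (geq_minr _ _) Hi.
Qed.

Lemma leq_Dmin u v u' v' :
  u' \in ball u -> v' \in ball v -> Dmin u v <= hamming u' v'.
Proof.
move=> Hu Hv; apply: leq_trans (geq_big_minn _ _ Hu) _.
exact: geq_big_minn.
Qed.

Lemma hammingxx u : hamming u u = 0.
Proof. by rewrite /hamming; elim: u => //= a u ->; rewrite eqxx. Qed.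

Lemma hamming_rcons u a b : hamming (rcons u a) (rcons u b) = (a != b).
Proof.
rewrite /hamming; elim: u => [|c u IH] /=; first by rewrite addn0.
by rewrite IH eqxx.
Qed.

Lemma Dmin_boundary u v w w' z : size u = size v ->
  z \in ball (u ++ w) -> z \in ball (v ++ w') -> Dmin u v <= 1.
Proof.
move=> suv /mem_ballP Hu /mem_ballP Hv.
have [u' [v' [/mem_ballP Bu /mem_ballP Bv]]] := adj_swap_boundary suv Hu Hv.
have := leq_Dmin Bu Bv => + E; case: E => [->|[z0 [a [b [-> ->]]]]].
  by rewrite hammingxx; lia.
by rewrite hamming_rcons; case: (a != b); lia.
Qed.

(** The pair from [adj_swap_boundary] has distance at most 1. By (E1) it attains [Dmin u v = 1],
    hence is a closest witness differing in the last coordinate, against (E2). *)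
Lemma same_length_test_boundary u v w w' z :
  size u = size v -> same_length_test u v ->
  z \in ball (u ++ w) -> z \notin ball (v ++ w').
Proof.
move=> suv [D0 D1] Hu; apply/negP=> Hv; have := Dmin_boundary suv Hu Hv.
rewrite leq_eqVlt ltnS leqn0 => /orP[/eqP Dm|/eqP] //.
move/mem_ballP in Hu; move/mem_ballP in Hv.
have [u' [v' [Su Sv E]]] := adj_swap_boundary suv Hu Hv.
have Bu : u' \in ball u by apply/mem_ballP.
have Bv : v' \in ball v by apply/mem_ballP.
have := leq_Dmin Bu Bv; rewrite Dm.
case: E => [->|[z0 [a [b [Eu Ev]]]]]; first by rewrite hammingxx.
rewrite Eu Ev hamming_rcons lt0b => ab.
have W : closest_witness u v u' v'.
  by split=> //; rewrite Eu Ev hamming_rcons ab.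
apply: (D1 Dm _ _ W).
have -> : (size u).-1 = size z0.
  by rewrite -(adj_swap_size Su) Eu size_rcons.
rewrite Eu Ev !onthE !map_rcons !nth_rcons !size_map ltnn eqxx => -[Eab].
by rewrite Eab eqxx in ab.
Qed.

End BoundaryTests.

(** * Collisions between concatenations of blocks *)

Section Codes.
Variable T : choiceType.
Variable P : {fset seq T}.
Implicit Types x y w z : seq T.

Lemma two_stage_test_boundary x y w w' z :
  size x < size y -> two_stage_test P x y -> star P w ->
  z \in ball (x ++ w) -> z \notin ball (y ++ w').
Proof.
move=> xy [D0 D1] Pw Hx; apply/negP=> Hy.
set d := size y - size x in D1; set y0 := take (size x) y in D0 D1.
have s0 : size x = size y0 by rewrite size_takel // ltnW.
(* Cutting [y] after [size x] letters bounds the distance by 1, and (U1) excludes 0. *)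
have Dm : Dmin x y0 = 1.
  have Hy' := Hy; rewrite -(cat_take_drop (size x) y) -catA in Hy'.
  have := Dmin_boundary s0 Hx Hy'.
  by move: D0; rewrite -/y0; case: (Dmin x y0) => [|[|k]].
(* Both words have the length of [z], so [w] is long enough to supply [rho] as its prefix of length
   [d]. *)
have dw : d <= size w.
  have /mem_ballP/adj_swap_size sx := Hx; have /mem_ballP/adj_swap_size sy := Hy.
  by rewrite leq_subLR -size_cat -sx sy size_cat leq_addr.
have tst : same_length_test (x ++ take d w) y by apply: D1 => //; exists w.
rewrite -(cat_take_drop d w) catA in Hx.
have sxy : size (x ++ take d w) = size y by rewrite size_cat size_takel // subnKC // ltnW.
by have := same_length_test_boundary w' sxy tst Hx; rewrite Hy.
Qed.

Hypothesis P_nonempty : forall x, x \in P -> x <> [::].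
Hypothesis C1 : forall u v, u \in P -> v \in P -> u <> v ->
  size u = size v -> same_length_test u v.
Hypothesis C2 : forall x y, x \in P -> y \in P ->
  size x < size y -> two_stage_test P x y.

Lemma colliding_first_block x y w w' z :
  x \in P -> y \in P -> star P w -> star P w' ->
  z \in ball (x ++ w) -> z \in ball (y ++ w') -> x = y.
Proof.
move=> Px Py Pw Pw' Hx Hy.
have [xy|yx|s] := ltngtP (size x) (size y).
- by have := two_stage_test_boundary w' xy (C2 Px Py xy) Pw Hx; rewrite Hy.
- by have := two_stage_test_boundary w yx (C2 Py Px yx) Pw' Hy; rewrite Hx.
have [//|/eqP xy] := eqVneq x y.
by have := same_length_test_boundary w' s (C1 Px Py xy s) Hx; rewrite Hy.
Qed.

(** Comparing block lists lets the induction strip one block from each side: the first blocks agree,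
    and cancelling them leaves a collision of the remaining lists. *)
Lemma star_flatten_ball_inj (ps ps' : seq (seq T)) z :
  {subset ps <= P} -> {subset ps' <= P} ->
  z \in ball (flatten ps) -> z \in ball (flatten ps') -> ps = ps'.
Proof.
elim: ps ps' z => [|x ps IH] [|y ps'] z //= Pps Pps' H H'.
(* Swaps preserve length, so [z] is empty, which rules out a nonempty block [y]. *)
- have := P_nonempty (Pps' y (mem_head _ _)).
  have /mem_ballP/adj_swap_size := H; have /mem_ballP/adj_swap_size -> := H'.
  by case: y {Pps' H'}.
- have := P_nonempty (Pps x (mem_head _ _)).
  have /mem_ballP/adj_swap_size := H; have /mem_ballP/adj_swap_size -> := H'.
  by case: x {Pps H}.
have sub : {subset ps <= P} by move=> t tps; apply: Pps; rewrite inE tps orbT.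
have sub' : {subset ps' <= P} by move=> t tps; apply: Pps'; rewrite inE tps orbT.
have E : x = y.
  apply: colliding_first_block H H'; [exact/Pps/mem_head|exact/Pps'/mem_head| |].
    by exists ps.
  by exists ps'.
rewrite -E in H' *; move/mem_ballP in H; move/mem_ballP in H'.
have [z' [/mem_ballP B /mem_ballP B']] := adj_swap_cancel H H'.
by rewrite (IH ps' z').
Qed.

End Codes.

Theorem theorem3 (q : nat) (q_gt0 : 0 < q) (P : {fset seq 'I_q})
  (P_nonempty : forall x : seq 'I_q, x \in P -> x <> [::])
  (C1 : forall u v : seq 'I_q, u \in P -> v \in P -> u <> v ->
          size u = size v -> same_length_test u v)
  (C2 : forall x y : seq 'I_q, x \in P -> y \in P ->
          size x < size y -> two_stage_test P x y) :
  forall n : nat, correcting (code P n).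
Proof.
move=> n c c' [[ps [Pps ->]] _] [[ps' [Pps' ->]] _] ne [z [H H']].
by apply: ne; rewrite (star_flatten_ball_inj P_nonempty C1 C2 Pps Pps' H H').
Qed.
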